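(* Set \[ L = L(2, 1, 1, 4, 2, 1, 1, -2),\qquad R = R(-7, -55, -11, 1, -27, -13, -19, 4). \] Then \[ M = L\cdot R= \left(\begin{array}{rrrrrrrr} 142 & 197 & -225 & 30 & 16 & 57 & -13 & -170 \\ -37 & -60 & 136 & 201 & 177 & 98 & -32 & -193 \\ -283 & -4 & -148 & -95 & 71 & 164 & 10 & -1 \\ -22 & 237 & 181 & -178 & 138 & -29 & -45 & -8 \\ -120 & 97 & 27 & 74 & -62 & -129 & 293 & -82 \\ -9 & 38 & -116 & 131 & 235 & -144 & 0 & 187 \\ -103 & 180 & 50 & 195 & -163 & 64 & -132 & 107 \\ -126 & -35 & -51 & -20 & -42 & -247 & -191 & -154 \end{array}\right) \] is a proper Euler's magic matrix (over $\mathbb{Z}$).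
   Context: Let $S$ be a commutative ring and $n$ a positive integer. A matrix $M=(m_{i,j})_{1\le i,j\le n}\in S^{n\times n}$ is called an Euler's magic matrix over $S$ if there is some $\gamma\in S\setminus\{0\}$ such that (i) $M\cdot M^t=\gamma\cdot I_n$, where $M^t$ is the transpose of $M$ and $I_n$ is the $n\times n$ identity matrix; (ii) $\sum_{i=1}^n m_{i,i}^2=\gamma$; and (iii) $\sum_{i=1}^n m_{i,n+1-i}^2=\gamma$. It is called a proper Euler's magic matrix if in addition the squares of its entries are pairwise distinct, i.e. $m_{i,j}^2\ne m_{k,l}^2$ whenever $(i,j)\ne(k,l)$. The $8\times 8$ matrices $L(\cdot)$ and $R(\cdot)$ are defined by \[L(a,b,c,d,e,f,g,h)= \left(\begin{array}{rrrrrrrr} a & -b & -c & -d & -e & -f & -g & -h \\ b & a & -d & c & -f & e & h & -g \\ c & d & a & -b & -g & -h & e & f \\ d & -c & b & a & -h & g & -f & e \\ e & f & g & h & a & -b & -c & -d \\ f & -e & h & -g & b & a & d & -c \\ g & -h & -e & f & c & -d & a & b \\ h & g & -f & -e & d & c & -b & a \end{array}\right) \] and \[R(p,q,r,s,t,u,v,w)= \left(\begin{array}{rrrrrrrr} p & -q & -r & -s & -t & -u & -v & -w \\ q & p & s & -r & u & -t & -w & v \\ r & -s & p & q & v & w & -t & -u \\ s & r & -q & p & w & -v & u & -t \\ t & -u & -v & -w & p & q & r & s \\ u & t & -w & v & -q & p & -s & r \\ v & w & t & -u & -r & s & p & -q \\ w & -v & u & t & -s & -r & q & p \end{array}\right).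 \] *)

(* Defs.v *)
From HB Require Import structures.
From mathcomp Require Import all_boot all_order all_algebra.

Set Implicit Arguments.
Unset Strict Implicit.
Unset Printing Implicit Defensive.

Import GRing.Theory.
Local Open Scope ring_scope.

(* [comPzRingType] rather than [comNzRingType]: a commutative ring may be the
   zero ring.  Matrix indices start at 0, so the antidiagonal position
   (i, n+1-i) of 1-based indexing is [M i (rev_ord i)].  The size n is meant to
   be positive; for n = 0 no matrix qualifies, since the empty diagonal sum
   forces gamma = 0. *)
Definition euler_magic (S : comPzRingType) (n : nat) (M : 'M[S]_n) : Prop :=
  exists gamma : S,
    [/\ gamma != 0,
        M *m M^T = gamma%:M,
        \sum_(i < n) M i i ^+ 2 = gamma &
        \sum_(i < n) M i (rev_ord i) ^+ 2 = gamma].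

Definition proper_euler_magic (S : comPzRingType) (n : nat) (M : 'M[S]_n) :
    Prop :=
  euler_magic M /\
  (forall i j k l : 'I_n, (i, j) <> (k, l) -> M i j ^+ 2 <> M k l ^+ 2).

(* Entries missing from [rows] are read as 0 and superfluous ones are ignored;
   every use below supplies eight rows of eight entries. *)
Definition mx_of_rows (S : comPzRingType) (n : nat) (rows : seq (seq S)) :
    'M[S]_n :=
  \matrix_(i < n, j < n) nth 0 (nth [::] rows i) j.

Definition Lmx (S : comPzRingType) (a b c d e f g h : S) : 'M[S]_8 :=
  mx_of_rows 8
  [:: [:: a; - b; - c; - d; - e; - f; - g; - h];
      [:: b; a; - d; c; - f; e; h; - g];
      [:: c; d; a; - b; - g; - h; e; f];
      [:: d; - c; b; a; - h; g; - f; e];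
      [:: e; f; g; h; a; - b; - c; - d];
      [:: f; - e; h; - g; b; a; d; - c];
      [:: g; - h; - e; f; c; - d; a; b];
      [:: h; g; - f; - e; d; c; - b; a]].

Definition Rmx (S : comPzRingType) (p q r s t u v w : S) : 'M[S]_8 :=
  mx_of_rows 8
  [:: [:: p; - q; - r; - s; - t; - u; - v; - w];
      [:: q; p; s; - r; u; - t; - w; v];
      [:: r; - s; p; q; v; w; - t; - u];
      [:: s; r; - q; p; w; - v; u; - t];
      [:: t; - u; - v; - w; p; q; r; s];
      [:: u; t; - w; v; - q; p; - s; r];
      [:: v; w; t; - u; - r; s; p; - q];
      [:: w; - v; u; t; - s; - r; q; p]].

(* Main.v *)
(** Each of the matrices [L(a,...,h)] and [R(p,...,w)] has pairwise orthogonal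
    rows of equal norm, as a polynomial identity in the parameters, so
    [(L R) (L R)^T = L (R R^T) L^T] is scalar, with
    gamma = (a^2+...+h^2) (p^2+...+w^2), here [32 * 4471]. *)

Require Import Defs.
From HB Require Import structures.
From mathcomp Require Import all_boot all_order all_algebra.
From mathcomp Require Import ring.

Import GRing.Theory Num.Theory.
Local Open Scope ring_scope.

(** Passing from ordinals to a function [G] on [nat] puts the indices in literal form, free of
    nested [widen_ord] terms, so that [nth] at these indices reduces under [/=]. *)
Lemma sum_ord8 (V : nmodType) (F : 'I_8 -> V) (G : nat -> V) :
  (forall i : 'I_8, F i = G i) ->
  \sum_(i < 8) F i =
    G 0%N + G 1%N + G 2%N + G 3%N + G 4%N + G 5%N + G 6%N + G 7%N.
Proof.
by move=> eqFG; rewrite (eq_bigr _ (fun i _ => eqFG i)) !big_ord_recr big_ord0 /= add0r.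
Qed.

Lemma mulmx_rows8 (S : comPzRingType) (rA rB : seq (seq S)) (i j : 'I_8) :
  (mx_of_rows 8 rA *m mx_of_rows 8 rB) i j =
  let a := nth [::] rA i in let b k := (nth [::] rB k)`_j in
  a`_0 * b 0%N + a`_1 * b 1%N + a`_2 * b 2%N + a`_3 * b 3%N
  + a`_4 * b 4%N + a`_5 * b 5%N + a`_6 * b 6%N + a`_7 * b 7%N.
Proof.
rewrite mxE.
pose G k := (nth [::] rA i)`_k * (nth [::] rB k)`_j.
by rewrite (@sum_ord8 _ _ G) // => k; rewrite !mxE.
Qed.

Lemma mulmx_tr_rows8 (S : comPzRingType) (rA : seq (seq S)) (i j : 'I_8) :
  (mx_of_rows 8 rA *m (mx_of_rows 8 rA)^T) i j =
  let a := nth [::] rA i in let b := nth [::] rA j in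
  a`_0 * b`_0 + a`_1 * b`_1 + a`_2 * b`_2 + a`_3 * b`_3
  + a`_4 * b`_4 + a`_5 * b`_5 + a`_6 * b`_6 + a`_7 * b`_7.
Proof.
rewrite mxE.
pose G k := (nth [::] rA i)`_k * (nth [::] rA j)`_k.
by rewrite (@sum_ord8 _ _ G) // => k; rewrite !mxE.
Qed.

Lemma Lmx_mul_tr (S : comPzRingType) (a b c d e f g h : S) :
  Lmx a b c d e f g h *m (Lmx a b c d e f g h)^T =
  (a ^+ 2 + b ^+ 2 + c ^+ 2 + d ^+ 2 + e ^+ 2 + f ^+ 2 + g ^+ 2 + h ^+ 2)%:M.
Proof.
apply/matrixP => i j; rewrite mulmx_tr_rows8 mxE.
(* There are 64 entries. Unfolding [eq_op] decides the factor [i == j] of the scalar matrix; what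
   remains is a polynomial identity in the parameters. *)
case: i => [[|[|[|[|[|[|[|[|//]]]]]]]] ?];
  case: j => [[|[|[|[|[|[|[|[|//]]]]]]]] ?]; rewrite /eq_op /= ?mulr1n ?mulr0n; ring.
Qed.

Lemma Rmx_mul_tr (S : comPzRingType) (p q r s t u v w : S) :
  Rmx p q r s t u v w *m (Rmx p q r s t u v w)^T =
  (p ^+ 2 + q ^+ 2 + r ^+ 2 + s ^+ 2 + t ^+ 2 + u ^+ 2 + v ^+ 2 + w ^+ 2)%:M.
Proof.
apply/matrixP => i j; rewrite mulmx_tr_rows8 mxE.
case: i => [[|[|[|[|[|[|[|[|//]]]]]]]] ?];
  case: j => [[|[|[|[|[|[|[|[|//]]]]]]]] ?]; rewrite /eq_op /= ?mulr1n ?mulr0n; ring.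
Qed.

Lemma mulmx_tr_scalar (S : comPzRingType) (n : nat) (A B : 'M[S]_n) (x y : S) :
  A *m A^T = x%:M -> B *m B^T = y%:M -> (A *m B) *m (A *m B)^T = (x * y)%:M.
Proof.
move=> hA hB; rewrite trmx_mul -mulmxA (mulmxA B) hB mul_scalar_mx.
by rewrite -scalemxAr hA scale_scalar_mx mulrC.
Qed.

Lemma nth_flatten_index (T : Type) (x0 : T) (ss : seq (seq T)) (r c : nat) :
  (c < nth 0%N (shape ss) r)%N ->
  nth x0 (flatten ss) (flatten_index (shape ss) r c) = nth x0 (nth [::] ss r) c.
Proof.
by move=> ltc; rewrite nth_flatten flatten_indexKl // flatten_indexKr.
Qed.

(** In an ordered domain, equal squares mean equal absolute values, so distinctness becomes a [uniq]
    test that can be run by computation. The [shape] hypothesis makes every matrix position a true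
    position of the flattened list, never a default value. *)
Lemma mx_of_rows_sqr_neq (R : realDomainType) (n : nat) (rows : seq (seq R)) :
  shape rows = nseq n n -> uniq [seq `|x| | x <- flatten rows] ->
  forall i j k l : 'I_n, (i, j) <> (k, l) ->
    mx_of_rows n rows i j ^+ 2 <> mx_of_rows n rows k l ^+ 2.
Proof.
move=> shE uniq_rows i j k l neq; rewrite !mxE.
have bound (r c : 'I_n) : (c < nth 0%N (shape rows) r)%N.
  by rewrite shE nth_nseq ltn_ord.
have lt_size (r c : 'I_n) :
    (flatten_index (shape rows) r c < size (flatten rows))%N.
  by rewrite size_flatten flatten_indexP.
rewrite -real_normK ?num_real // -[RHS]real_normK ?num_real //.
move/eqP; rewrite eqrXn2 // -!nth_flatten_index //.
rewrite -!(nth_map 0 0 Num.norm) // nth_uniq ?size_map // => /eqP eq_idx.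
(* A valid flattened index determines its row and its column. *)
case: neq; congr pair; apply: val_inj => /=.
  by rewrite -(flatten_indexKl (bound i j)) eq_idx flatten_indexKl.
by rewrite -(flatten_indexKr (bound i j)) eq_idx flatten_indexKr.
Qed.

Theorem theorem1p3 :
  let L : 'M[int]_8 := Lmx 2 1 1 4 2 1 1 (-2) in
  let R : 'M[int]_8 := Rmx (-7) (-55) (-11) 1 (-27) (-13) (-19) 4 in
  let M : 'M[int]_8 := L *m R in
  M = mx_of_rows 8
    [:: [:: 142; 197; -225; 30; 16; 57; -13; -170];
        [:: -37; -60; 136; 201; 177; 98; -32; -193];
        [:: -283; -4; -148; -95; 71; 164; 10; -1];
        [:: -22; 237; 181; -178; 138; -29; -45; -8];
        [:: -120; 97; 27; 74; -62; -129; 293; -82];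
        [:: -9; 38; -116; 131; 235; -144; 0; 187];
        [:: -103; 180; 50; 195; -163; 64; -132; 107];
        [:: -126; -35; -51; -20; -42; -247; -191; -154]]%Z
  /\ proper_euler_magic M.
Proof.
move=> L R M; set rows := (X in mx_of_rows 8 X).
have eqM : M = mx_of_rows 8 rows.
  apply/matrixP => i j; rewrite mulmx_rows8 mxE.
  by case: i => [[|[|[|[|[|[|[|[|//]]]]]]]] ?];
    case: j => [[|[|[|[|[|[|[|[|//]]]]]]]] ?]; rewrite /=; ring.
(* Both the shape and the [uniq] condition hold by evaluation on the explicit [rows]. *)
split=> //; split; last by rewrite eqM; apply: mx_of_rows_sqr_neq.
have eqMM : M *m M^T = (32 * 4471)%:M.
  by apply: mulmx_tr_scalar; rewrite ?Lmx_mul_tr ?Rmx_mul_tr; congr _%:M; ring.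
exists (32 * 4471); split=> //; rewrite eqM.
(* The two diagonal conditions do not come from orthogonality; they are checked numerically on the
   explicit entries. *)
- rewrite (@sum_ord8 _ _ (fun i => (nth [::] rows i)`_i ^+ 2)) /=; first ring.
  by move=> i; rewrite mxE.
(* [8 - i.+1] is the value of [rev_ord i]. *)
- rewrite (@sum_ord8 _ _ (fun i => (nth [::] rows i)`_(8 - i.+1) ^+ 2)) /=; first ring.
  by move=> i; rewrite mxE.
Qed.
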